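(* Let $m\ge 2$ and let $A,A_2,\dots,A_m$ be real symmetric $n\times n$ matrices such that (i) $\|A\|=1$ and $\operatorname{tr}(A)=0$; (ii) $\langle A_\alpha,A_\beta\rangle=0$ for all $2\le\alpha<\beta\le m$; (iii) $\|A_2\|\ge\cdots\ge\|A_m\|$. Then $$\sum_{\alpha=2}^m\big\|[A,A_\alpha]\big\|^2\le\|A_2\|^2+\sum_{\alpha=2}^{\min\{m,n\}}\|A_\alpha\|^2.$$
   Context: For real $n\times n$ matrices, $\langle A,B\rangle=\operatorname{tr}(AB^T)$ and $\|A\|=\sqrt{\langle A,A\rangle}$ (Hilbert–Schmidt norm); $[A,B]=AB-BA$. *)

(* Defs.v *)
From HB Require Import structures.
From mathcomp Require Import all_boot all_order all_algebra.
From mathcomp Require Import reals.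

Set Implicit Arguments.
Unset Strict Implicit.
Unset Printing Implicit Defensive.

Import Order.TTheory GRing.Theory Num.Theory.
Local Open Scope ring_scope.

Definition hsdot (R : realType) (n : nat) (A B : 'M[R]_n) : R :=
  \tr (A *m B^T).

(* Not the norm `|A| that MathComp-Analysis puts on matrices, which is the
   maximum of the absolute values of the entries. *)
Definition hsnorm (R : realType) (n : nat) (A : 'M[R]_n) : R :=
  Num.sqrt (hsdot A A).

Definition mxcommutator (R : realType) (n : nat) (A B : 'M[R]_n) : 'M[R]_n :=
  A *m B - B *m A.

(* Main.v *)
(* In an orthonormal basis diagonalising A, with eigenvalues l i, the squared
   norm of [A, C] is the sum of C i j ^+ 2 * (l i - l j) ^+ 2.  For k orthonormal
   symmetric matrices E a, the weights w i j = \sum_a E a i j ^+ 2 have total k,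
   and are at most 1/2 off the diagonal by Bessel's inequality.  Then
   \sum_a |[A, E a]|^2 <= 1 + k follows from
   \sum_(i < j) max((l i - l j)^2 - 1, 0) <= 1,
   where the pairs that contribute form a star, and
   \sum_a |[A, E a]|^2 <= n from \sum_(i < j) (l i - l j)^2 <= n.
   Normalising the A_a and summing by parts against the decreasing squared
   norms gives the theorem. *)

Require Import Defs.
From HB Require Import structures.
From mathcomp Require Import all_boot all_order all_algebra.
From mathcomp Require Import reals.
From mathcomp Require Import zify ring lra complex.

Set Implicit Arguments.
Unset Strict Implicit.
Unset Printing Implicit Defensive.

Import Order.TTheory GRing.Theory Num.Theory.
Local Open Scope ring_scope.

(** * Spectral theorem for real symmetric matrices *)

(** The complexification [A'] has an eigenvector [v] for some [c]. With [w] the adjoint of [v], the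
    scalar [v *m A' *m w] is self-conjugate and equals [c * q] with [q > 0], so [c] is real and is a
    root of the characteristic polynomial of [A]. *)
Lemma eigenvalue_symmetric (R : rcfType) n (A : 'M[R]_n) :
  (0 < n)%N -> A^T = A -> exists c, eigenvalue A c.
Proof.
move=> n_gt0 symA; pose f := real_complex R; pose A' := map_mx f A.
have [c /eigenvalueP [v vA v_neq0]] := spectral.eigenvalue_closed A' n_gt0.
pose w := (map_mx Num.conj v)^T; pose q := (v *m w) 0 0.
have q_gt0 : 0 < q.
  have [j vj_neq0] : exists j, v 0 j != 0.
    by move/rV0Pn: v_neq0.
  rewrite /q mxE (bigD1 j) //= ltr_wpDr //.
    by apply: sumr_ge0 => i _; rewrite !mxE mul_conjC_ge0.
  by rewrite !mxE mul_conjC_gt0.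
have conjA' : map_mx Num.conj A' = A'.
  by apply/matrixP => i j; rewrite !mxE; apply/CrealP; rewrite complex_real.
have conjw : map_mx Num.conj w = v^T.
  by apply/matrixP => i j; rewrite !mxE conjCK.
have symA' : A'^T = A' by rewrite map_trmx symA.
have EN : v *m A' *m w = (c * q)%:M.
  by rewrite vA -scalemxAl [v *m w]mx11_scalar -/q scale_scalar_mx.
have c_real : c \is Num.real.
  have cqE : Num.conj (c * q) = c * q.
    have /matrixP/(_ 0 0) : map_mx Num.conj (v *m A' *m w) = (v *m A' *m w)^T.
      by rewrite !map_mxM conjA' conjw !trmx_mul symA' trmxK mulmxA.
    by rewrite EN !mxE !mulr1n.
  have cq_real : c * q \is Num.real by apply/CrealP.
  by rewrite -(mulfK (lt0r_neq0 q_gt0) c) rpred_div // gtr0_real.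
exists (complex.Re c).
rewrite eigenvalue_root_char -(fmorph_root f) map_char_poly.
rewrite -eigenvalue_root_char; apply/eigenvalueP; exists v => //.
by rewrite vA; congr (_ *: _); exact/esym/RRe_real.
Qed.

(** [H] is the reflection in the hyperplane orthogonal to [v - e], which exchanges [v] and the first
    basis vector [e]. *)
Lemma householder (R : rcfType) n (v : 'rV[R]_n.+1) : v *m v^T = 1%:M ->
  exists H : 'M[R]_n.+1,
    [/\ H^T = H, H *m H = 1%:M & v *m H = delta_mx 0 0].
Proof.
move=> v1; pose e : 'rV[R]_n.+1 := delta_mx 0 0; pose w := v - e.
pose q := 2 - 2 * v 0 0.
have e1 : e *m e^T = 1%:M.
  by rewrite trmx_delta mul_delta_mx; apply/matrixP => i j; rewrite !mxE !ord1.
have ve : v *m e^T = (v 0 0)%:M.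
  by rewrite trmx_delta -colE; apply/matrixP => i j; rewrite !mxE !ord1 mulr1n.
have ev : e *m v^T = (v 0 0)%:M.
  by rewrite -[LHS]trmxK trmx_mul trmxK ve tr_scalar_mx.
have ww : w *m w^T = q%:M.
  rewrite /w linearB /= mulmxBl !mulmxBr v1 e1 ve ev -!raddfB; congr (_%:M).
  by rewrite /q; ring.
have vw : v *m w^T = (q / 2)%:M.
  rewrite /w linearB /= mulmxBr v1 ve -raddfB; congr (_%:M).
  by rewrite /q; field.
(* When v is already the first basis vector, q = 0 and the junk value 2 / 0 = 0
   makes H the identity, as desired. *)
exists (1%:M - (2 / q) *: (w^T *m w)); split.
- by rewrite linearB linearZ /= trmx_mul trmxK trmx1.
- rewrite mulmxBl mul1mx [X in _ - X]mulmxBr mulmx1.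
  rewrite -scalemxAl -scalemxAr scalerA mulmxA -(mulmxA w^T) ww.
  rewrite mul_mx_scalar -scalemxAl scalerA.
  suff -> : 2 / q * (2 / q) * q = 2 / q + 2 / q.
    by rewrite scalerDl opprB addrK subrK.
  by have [->|q0] := eqVneq q 0; [rewrite invr0; ring | field].
- rewrite mulmxBr mulmx1 -scalemxAr mulmxA vw mul_scalar_mx scalerA.
  have [q0|q0] := eqVneq q 0; last first.
    suff -> : 2 / q * (q / 2) = 1 by rewrite scale1r /w opprB addrC subrK.
    by field.
  suff w0 : w = 0 by rewrite w0 scaler0 subr0; apply/eqP; rewrite -subr_eq0 -/e -/w w0.
  move: ww; rewrite q0 => /matrixP /(_ 0 0); rewrite !mxE mul0rn => /eqP.
  rewrite psumr_eq0 => [/allP ww0|i _]; last by rewrite !mxE -expr2 sqr_ge0.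
  apply/rowP => j; have := ww0 j (mem_index_enum j).
  by rewrite !mxE -expr2 sqrf_eq0 => /eqP.
Qed.

(** Induction on [n]: a Householder reflection sends a unit eigenvector to the first basis vector.
    This splits off a 1 by 1 block, and the remaining block is again symmetric. *)
Lemma symmetric_diagonalizable (R : rcfType) n (A : 'M[R]_n) : A^T = A ->
  exists (P : 'M[R]_n) (d : 'rV[R]_n),
    P *m P^T = 1%:M /\ P *m A *m P^T = diag_mx d.
Proof.
elim: n A => [|n IHn] A symA.
  by exists 1%:M, 0; split; apply/matrixP => -[].
have [c /eigenvalueP [u uA u_neq0]] := eigenvalue_symmetric (ltn0Sn n) symA.
pose s := (u *m u^T) 0 0.
have s_gt0 : 0 < s.
  have /rV0Pn [j uj_neq0] := u_neq0.
  rewrite /s mxE (bigD1 j) //= ltr_wpDr //.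
    by apply: sumr_ge0 => i _; rewrite !mxE -expr2 sqr_ge0.
  by rewrite !mxE -expr2 exprn_even_gt0.
pose v := (Num.sqrt s)^-1 *: u.
have v1 : v *m v^T = 1%:M.
  rewrite /v linearZ /= -scalemxAl -scalemxAr scalerA [u *m _]mx11_scalar -/s.
  rewrite -mul_scalar_mx -scalar_mxM -expr2 exprVn sqr_sqrtr ?ltW// mulVf//.
  by rewrite gt_eqF.
have vA : v *m A = c *: v by rewrite -scalemxAl uA !scalerA mulrC.
have [H [symH HH vH]] := householder v1.
pose A1 : 'M[R]_(1 + n) := H *m A *m H.
have symA1 : A1^T = A1 by rewrite /A1 !trmx_mul symH symA mulmxA.
have eA1 : (delta_mx 0 0 : 'rV_(1 + n)) *m A1 = c *: delta_mx 0 0.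
  by rewrite -vH /A1 scalemxAl -vA !mulmxA -(mulmxA v H H) HH mulmx1.
have A1E : A1 = block_mx c%:M 0 0 (drsubmx A1).
  have A1_row0 j : A1 0 j = c * (j == 0)%:R.
    have /rowP/(_ j) := eA1.
    by rewrite -rowE [in LHS]mxE [in RHS]mxE [in RHS]mxE eqxx.
  have ur0 : ursubmx A1 = 0.
    apply/matrixP => i j; rewrite [LHS]mxE [LHS]mxE [RHS]mxE ord1 lshift0 A1_row0.
    by rewrite mulr0.
  have ul0 : ulsubmx A1 = c%:M.
    apply/matrixP => i j; rewrite [LHS]mxE [LHS]mxE !ord1 lshift0 A1_row0.
    by rewrite !mxE eqxx mulr1.
  rewrite -[LHS]submxK ur0 ul0; congr block_mx.
  by rewrite -[A1]symA1 -trmx_ursub ur0 trmx0.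
have symD : (drsubmx A1)^T = drsubmx A1 by rewrite trmx_drsub symA1.
have [Q [d [QQ QD]]] := IHn _ symD.
pose P1 : 'M[R]_(1 + n) := block_mx 1%:M 0 0 Q.
have P1P1 : P1 *m P1^T = 1%:M.
  rewrite /P1 tr_block_mx mulmx_block !trmx1 !trmx0.
  by rewrite !(mulmx0, mul0mx, mulmx1, mul1mx, addr0, add0r) QQ -scalar_mx_block.
have P1A1 : P1 *m A1 *m P1^T = diag_mx (row_mx c%:M d).
  rewrite A1E /P1 tr_block_mx !mulmx_block !trmx1 !trmx0.
  rewrite !(mulmx0, mul0mx, mulmx1, mul1mx, addr0, add0r) QD diag_mx_row.
  by congr block_mx; apply/matrixP => i j; rewrite !mxE !ord1.
exists (P1 *m H), (row_mx c%:M d); split.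
  by rewrite trmx_mul symH mulmxA -(mulmxA P1) HH mulmx1.
by rewrite trmx_mul symH -P1A1 /A1 !mulmxA.
Qed.

(** * Inequalities for squared gaps and weighted sums of reals *)

Lemma star_gap_excess (R : realFieldType) (I : finType) (l : I -> R) (c : I) :
  \sum_i l i ^+ 2 = 1 ->
  \sum_j Num.max ((l c - l j) ^+ 2 - 1) 0 <= 1.
Proof.
move=> l1; pose S := [pred j | 1 < (l c - l j) ^+ 2].
have -> : \sum_j Num.max ((l c - l j) ^+ 2 - 1) 0 =
    \sum_(j in S) ((l c - l j) ^+ 2 - 1).
  rewrite [RHS]big_mkcond; apply: eq_bigr => j _; rewrite inE.
  by case: ltP => h; [rewrite max_l // subr_ge0 ltW | rewrite max_r // subr_le0].
pose k : R := #|S|%:R; pose s := \sum_(j in S) l j.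
pose t := \sum_(j in S) l j ^+ 2.
have quad x : \sum_(j in S) (x - l j) ^+ 2 = k * x ^+ 2 - 2 * x * s + t.
  rewrite (eq_bigr (fun j => x ^+ 2 - 2 * x * l j + l j ^+ 2)); last first.
    by move=> j _; ring.
  by rewrite big_split sumrB /= sumr_const -mulr_sumr -[_ *+ #|_|]mulr_natl.
have lt1 : l c ^+ 2 + t <= 1.
  rewrite -l1 (bigD1 c) //= lerD2l /t big_mkcond [leRHS]big_mkcond /=.
  apply: ler_sum => j _; rewrite inE; have [->|_] /= := eqVneq j c.
    by rewrite subrr expr0n ltNge ler01.
  by case: ifP => _ //; apply: sqr_ge0.
have cauchy : s ^+ 2 <= k * t.
  have [k0|k_neq0] := eqVneq k 0.
    have S0 : S =i pred0.
      by apply: card0_eq; apply/eqP; rewrite -(pnatr_eq0 R) -/k k0.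
    by rewrite /s big_pred0 // expr0n k0 mul0r.
  have k_gt0 : 0 < k by rewrite lt0r k_neq0 ler0n.
  (* Cauchy-Schwarz, as nonnegativity of the squared deviations from the mean [s / k]. *)
  have : 0 <= \sum_(j in S) (s / k - l j) ^+ 2 by apply: sumr_ge0 => j _; apply: sqr_ge0.
  rewrite quad -(pmulr_rge0 _ k_gt0) -[s ^+ 2 <= _]subr_ge0.
  by apply: etrans; congr (0 <= _); field.
have k_ge0 : 0 <= k by apply: ler0n.
rewrite sumrB sumr_const -/k quad.
(* One minus the sum equals [(k + 1) * (1 - (l c ^+ 2 + t)) + (l c + s) ^+ 2 + (k * t - s ^+ 2)],
   three nonnegative terms. *)
have : 0 <= (k + 1) * (1 - (l c ^+ 2 + t)) by apply: mulr_ge0; lra.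
have : 0 <= (l c + s) ^+ 2 by apply: sqr_ge0.
by lra.
Qed.

(* Two disjoint pairs of gaps exceeding 1 would give total norm above 1, and
   a triangle of such pairs is impossible since l i and l j must then have
   opposite signs; hence these pairs form a star. *)
Lemma sum_gap_excess (R : realFieldType) (I : finType) (l : I -> R) :
  \sum_i l i ^+ 2 = 1 ->
  \sum_i \sum_j Num.max ((l i - l j) ^+ 2 - 1) 0 <= 2.
Proof.
move=> l1; pose f i j := Num.max ((l i - l j) ^+ 2 - 1) 0.
rewrite -[leLHS]/(\sum_i \sum_j f i j).
pose T i j := 1 < (l i - l j) ^+ 2.
have f_ge0 i j : 0 <= f i j by rewrite le_max lexx orbT.
have fC i j : f i j = f j i by rewrite /f -sqrrN opprB.
have TC i j : T i j = T j i by rewrite /T -sqrrN opprB.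
have f0 i j : ~~ T i j -> f i j = 0.
  by rewrite -leNgt => h; rewrite /f max_r // subr_le0.
have Tneq i j : T i j -> i != j.
  by apply: contraTneq => ->; rewrite /T subrr expr0n ltNge ler01.
have le1 i j : i != j -> l i ^+ 2 + l j ^+ 2 <= 1.
  move=> ij; rewrite -l1 (bigD1 i) //= lerD2l (bigD1 j) /= 1?eq_sym // lerDl.
  by apply: sumr_ge0 => *; apply: sqr_ge0.
have Tneg i j : T i j -> l i * l j < 0.
  by move=> Tij; have := le1 _ _ (Tneq _ _ Tij); move: Tij; rewrite /T; lra.
have Tmeet i j p q : T i j -> T p q -> [|| p == i, p == j, q == i | q == j].
  move=> Tij Tpq; apply/negPn/negP; rewrite !negb_or => /and4P [pi pj qi qj].
  have : l i ^+ 2 + (l j ^+ 2 + (l p ^+ 2 + l q ^+ 2)) <= 1.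
    rewrite -l1 (bigD1 i) //= lerD2l (bigD1 j) /= 1?eq_sym ?Tneq // lerD2l.
    rewrite (bigD1 p) /= ?pi ?pj // lerD2l (bigD1 q) /=; last first.
      by rewrite qi qj eq_sym Tneq.
    by rewrite lerDl; apply: sumr_ge0 => *; apply: sqr_ge0.
  (* By the parallelogram law, [(x - y) ^+ 2 > 1] and [(x + y) ^+ 2 >= 0] give
     [x ^+ 2 + y ^+ 2 > 1 / 2]; this applies to both pairs. *)
  have := sqr_ge0 (l i + l j); have := sqr_ge0 (l p + l q).
  by move: Tij Tpq; rewrite /T; lra.
have Ttri i j p : T i j -> T j p -> T i p -> False.
  move=> /Tneg ij /Tneg jp /Tneg ip.
  (* The three pairwise products multiply to a square, so they cannot all be negative. *)
  have : 0 < (l i * l j) * (l j * l p) by rewrite nmulr_rgt0.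
  have : 0 <= (l i * l j * l p) ^+ 2 by apply: sqr_ge0.
  have -> : (l i * l j * l p) ^+ 2 = l i * l j * (l j * l p) * (l i * l p) by ring.
  by move=> h1 h2; move: h1; rewrite pmulr_rge0 // leNgt ip.
have [[i0 j0] /= T0|noT] := pickP (fun p => T p.1 p.2); last first.
  rewrite big1 // => i _; rewrite big1 // => j _.
  by rewrite f0 //; have /= -> := noT (i, j).
(* The centre is [i0] if [j0] has no other neighbour. Otherwise [j0] is the only neighbour of [i0],
   and the centre is [j0]. *)
have [c Tc] : exists c, forall i j, T i j -> (i == c) || (j == c).
  have [/forallP all_i0|] := boolP [forall p, T j0 p ==> (p == i0)].
    have {}all_i0 p : T j0 p -> p == i0 by apply/implyP.
    exists i0 => i j Tij; case/or4P: (Tmeet _ _ _ _ T0 Tij) => /eqP E.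
    - by rewrite E eqxx.
    - by rewrite (all_i0 j) ?orbT // -E.
    - by rewrite E eqxx orbT.
    - by rewrite all_i0 // -E TC.
  rewrite negb_forall => /existsP [p]; rewrite negb_imply => /andP [Tp pi0].
  have all_j0 j : T i0 j -> j == j0.
    move=> Tj; case/or4P: (Tmeet _ _ _ _ Tp Tj) => /eqP E //.
    - by have := Tneq _ _ T0; rewrite E eqxx.
    - by rewrite E eqxx in pi0.
    - by case: (Ttri _ _ _ T0 Tp); rewrite -E.
  exists j0 => i j Tij; case/or4P: (Tmeet _ _ _ _ T0 Tij) => /eqP E.
  - by rewrite (all_j0 j) ?orbT // -E.
  - by rewrite E eqxx.
  - by rewrite all_j0 // -E TC.
  - by rewrite E eqxx orbT.
(* Each pair is counted twice, once in row [c] and once in column [c]; the star bound gives at most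
   1 for each. *)
have star := star_gap_excess c l1; rewrite (bigD1 c) //=.
apply: lerD; first exact: star.
apply: le_trans star; rewrite [leRHS](bigD1 c) //= -[leLHS]add0r.
apply: lerD; first exact: f_ge0.
apply: ler_sum => i ic; rewrite (bigD1 c) //= fC big1 ?addr0 // => j jc.
by apply/f0/negP => /Tc; rewrite (negPf ic) (negPf jc).
Qed.

(** For a squared gap [g] off the diagonal, [w i j * g <= w i j + 2^-1 * Num.max (g - 1) 0], and the
    excesses over ordered pairs total at most 2. On the diagonal the gap vanishes. *)
Lemma sum_weighted_gaps_le (R : realFieldType) (I : finType) (l : I -> R)
    (w : I -> I -> R) (k : R) :
  \sum_i l i ^+ 2 = 1 -> (forall i j, 0 <= w i j) ->
  (forall i j, i != j -> w i j <= 2^-1) -> \sum_i \sum_j w i j <= k ->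
  \sum_i \sum_j w i j * (l i - l j) ^+ 2 <= 1 + k.
Proof.
move=> l1 w_ge0 w_le wk.
pose f i j := Num.max ((l i - l j) ^+ 2 - 1) 0.
have f_ge0 i j : 0 <= f i j by rewrite le_max lexx orbT.
apply: (@le_trans _ _ (\sum_i \sum_j (2^-1 * f i j + w i j))).
  apply: ler_sum => i _; apply: ler_sum => j _.
  rewrite -lerBlDr -{2}(mulr1 (w i j)) -mulrBr.
  have [->|/w_le wij] := eqVneq i j.
    rewrite subrr expr0n /= sub0r mulrN1 (le_trans (y := 0)) ?oppr_le0 //.
    by rewrite mulr_ge0 // invr_ge0.
  apply: (@le_trans _ _ (w i j * f i j)); last exact: ler_wpM2r.
  by apply: ler_wpM2l => //; rewrite le_max lexx.
under eq_bigr do rewrite big_split -mulr_sumr.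
rewrite big_split -mulr_sumr /= lerD // -[leRHS](@mulVf _ 2) ?pnatr_eq0 //.
by rewrite ler_wpM2l ?invr_ge0 // sum_gap_excess.
Qed.

(** With every weight raised to 1/2 the sum is [#|I|%:R - (\sum_i l i) ^+ 2]. *)
Lemma sum_weighted_gaps_le_card (R : realFieldType) (I : finType) (l : I -> R)
    (w : I -> I -> R) :
  \sum_i l i ^+ 2 = 1 ->
  (forall i j, i != j -> w i j <= 2^-1) ->
  \sum_i \sum_j w i j * (l i - l j) ^+ 2 <= #|I|%:R.
Proof.
move=> l1 w_le.
apply: (@le_trans _ _ (\sum_i \sum_j 2^-1 * (l i - l j) ^+ 2)).
  apply: ler_sum => i _; apply: ler_sum => j _.
  have [->|/w_le wij] := eqVneq i j; first by rewrite subrr expr0n !mulr0.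
  by rewrite ler_wpM2r ?sqr_ge0.
have E i j : 2^-1 * (l i - l j) ^+ 2 =
  2^-1 * l i ^+ 2 + (2^-1 * l j ^+ 2 - l i * l j) by field.
under eq_bigr => i _ do under eq_bigr => j _ do rewrite E.
under eq_bigr => i _ do
  rewrite !big_split /= sumr_const sumrN -!mulr_sumr l1 -[_ *+ #|_|]mulr_natl.
rewrite !big_split /= sumr_const sumrN -!mulr_sumr -mulr_suml l1.
rewrite -[_ *+ #|_|]mulr_natl; have := sqr_ge0 (\sum_i l i); lra.
Qed.

(* Abel summation: by induction, the sum up to k is at most b k times the
   k-th partial sum of y. *)
Lemma sum_decr_mul_le0 (R : realDomainType) (b y : nat -> R) (N : nat) :
  (forall i, (i < N)%N -> 0 <= b i) ->
  (forall i, (i.+1 < N)%N -> b i.+1 <= b i) ->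
  (forall k, (k <= N)%N -> \sum_(i < k) y i <= 0) ->
  \sum_(i < N) b i * y i <= 0.
Proof.
case: N => [|N] b_ge0 b_decr y_le0; first by rewrite big_ord0.
apply: (@le_trans _ _ (b N * \sum_(i < N.+1) y i)); last first.
  by rewrite mulr_ge0_le0 ?b_ge0 ?y_le0.
elim: N b_ge0 b_decr y_le0 => [|N IHN] b_ge0 b_decr y_le0.
  by rewrite !big_ord1.
rewrite big_ord_recr [in leRHS]big_ord_recr /= mulrDr lerD2r.
apply: (le_trans (IHN _ _ _)) => [i /ltnW|i /ltnW|k /leqW|]; auto.
by rewrite ler_wnM2r ?y_le0 ?b_decr.
Qed.

Lemma sum_ord_mul_ltn (R : pzRingType) (F : nat -> R) (k p : nat) :
  \sum_(i < k) F i * (i < p)%:R = \sum_(i < minn k p) F i.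
Proof.
rewrite (big_ord_widen _ F (geq_minl k p)) [RHS]big_mkcond /=.
by apply: eq_bigr => i _; rewrite ltn_min ltn_ord mulr_natr mulrb.
Qed.

(** * Hilbert-Schmidt inner product, commutators and Bessel's inequality *)

Section HilbertSchmidt.
Variables (R : realType) (n : nat).
Implicit Types A B X P : 'M[R]_n.

Lemma hsdotE A B : hsdot A B = \sum_i \sum_j A i j * B i j.
Proof. by apply: eq_bigr => i _; rewrite mxE; apply: eq_bigr => j _; rewrite mxE. Qed.

Lemma hsdotC A B : hsdot A B = hsdot B A.
Proof. by rewrite !hsdotE; do 2!apply: eq_bigr => ? _; rewrite mulrC. Qed.

Lemma hsdotDl A B X : hsdot (A + B) X = hsdot A X + hsdot B X.
Proof. by rewrite /hsdot mulmxDl linearD. Qed.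

Lemma hsdotBl A B X : hsdot (A - B) X = hsdot A X - hsdot B X.
Proof. by rewrite /hsdot mulmxBl linearB. Qed.

Lemma hsdotZl c A B : hsdot (c *: A) B = c * hsdot A B.
Proof. by rewrite /hsdot -scalemxAl linearZ. Qed.

Lemma hsdotZr c A B : hsdot A (c *: B) = c * hsdot A B.
Proof. by rewrite hsdotC hsdotZl hsdotC. Qed.

Lemma hsdot_suml (I : finType) (E : I -> 'M[R]_n) X :
  hsdot (\sum_a E a) X = \sum_a hsdot (E a) X.
Proof. by rewrite /hsdot mulmx_suml linear_sum. Qed.

Lemma hsdot_delta i j A : hsdot (delta_mx i j) A = A i j.
Proof.
rewrite hsdotE (bigD1 i) //= (bigD1 j) //= mxE !eqxx mul1r.
rewrite !big1 ?addr0 // => [k ki|k kj].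
  by apply: big1 => l _; rewrite mxE (negPf ki) mul0r.
by rewrite mxE eqxx (negPf kj) mul0r.
Qed.

Lemma hsdot_ge0 A : 0 <= hsdot A A.
Proof. by rewrite hsdotE; do 2!apply: sumr_ge0 => ? _; apply: sqr_ge0. Qed.

Lemma hsnorm_sqr A : hsnorm A ^+ 2 = hsdot A A.
Proof. by rewrite sqr_sqrtr // hsdot_ge0. Qed.

Lemma hsnorm_eq0 A : hsnorm A = 0 -> A = 0.
Proof.
move=> A0; have := hsnorm_sqr A; rewrite A0 expr0n hsdotE => /esym/eqP.
rewrite psumr_eq0 => [/allP A0i|i _]; last by apply: sumr_ge0 => j _; apply: sqr_ge0.
apply/matrixP => i j; have := A0i i (mem_index_enum i).
rewrite psumr_eq0 => [/allP/(_ j (mem_index_enum j))|k _]; last exact: sqr_ge0.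
by rewrite /= -expr2 sqrf_eq0 mxE => /eqP.
Qed.

Lemma hsdot_conj P A B : P *m P^T = 1%:M ->
  hsdot (P *m A *m P^T) (P *m B *m P^T) = hsdot A B.
Proof.
move=> /mulmx1C PP; rewrite /hsdot !trmx_mul trmxK !mulmxA.
by rewrite -(mulmxA (P *m A)) PP mulmx1 mxtrace_mulC !mulmxA PP mul1mx.
Qed.

Lemma mxcommutator_conj P A B : P *m P^T = 1%:M ->
  mxcommutator (P *m A *m P^T) (P *m B *m P^T) = P *m mxcommutator A B *m P^T.
Proof.
move=> /mulmx1C PP; rewrite /mxcommutator mulmxBr mulmxBl !mulmxA.
by rewrite -(mulmxA (P *m A)) PP mulmx1 -(mulmxA (P *m B)) PP mulmx1.
Qed.

(** The commutator has entries [(d 0 i - d 0 j) * B i j]. *)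
Lemma mxcommutator_diag (d : 'rV[R]_n) B :
  hsdot (mxcommutator (diag_mx d) B) (mxcommutator (diag_mx d) B) =
  \sum_i \sum_j B i j ^+ 2 * (d 0 i - d 0 j) ^+ 2.
Proof.
rewrite hsdotE; apply: eq_bigr => i _; apply: eq_bigr => j _.
rewrite /mxcommutator mul_diag_mx mul_mx_diag !mxE; ring.
Qed.

Section Bessel.
Variables (I : finType) (E : I -> 'M[R]_n).
Hypothesis orthE : forall a b, a != b -> hsdot (E a) (E b) = 0.
Hypothesis normE : forall a, hsdot (E a) (E a) <= 1.

(** Expand the squared norm of [X - S]. Norms at most 1 suffice for [hsdot S S <= hsdot S X], so the
    family may contain zero matrices. *)
Lemma bessel X : \sum_a hsdot X (E a) ^+ 2 <= hsdot X X.
Proof.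
pose c a := hsdot X (E a); pose S := \sum_a c a *: E a.
have SE b : hsdot S (E b) = c b * hsdot (E b) (E b).
  rewrite hsdot_suml (bigD1 b) //= hsdotZl big1 ?addr0 // => a ab.
  by rewrite hsdotZl orthE ?mulr0.
have XS : hsdot S X = \sum_a c a ^+ 2.
  by rewrite hsdot_suml; apply: eq_bigr => a _; rewrite hsdotZl hsdotC.
have SS : hsdot S S <= \sum_a c a ^+ 2.
  rewrite {1}/S hsdot_suml; apply: ler_sum => a _.
  by rewrite hsdotZl hsdotC SE mulrA -expr2 ler_piMr ?sqr_ge0.
have := hsdot_ge0 (X - S); rewrite hsdotBl ![hsdot _ (X - S)]hsdotC !hsdotBl.
by rewrite [hsdot X S]hsdotC XS; rewrite -/c; lra.
Qed.

Hypothesis symE : forall a, (E a)^T = E a.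

(** Bessel's inequality for [delta_mx i j + delta_mx j i], whose squared norm is 2 and whose inner
    product with the symmetric [E a] is [2 * E a i j]. *)
Lemma sum_entry_sqr_le i j : i != j -> \sum_a E a i j ^+ 2 <= 2^-1.
Proof.
move=> ij; have := bessel (delta_mx i j + delta_mx j i).
rewrite hsdotDl !hsdot_delta !mxE !eqxx (negPf ij) eq_sym (negPf ij) /= addr0 add0r.
rewrite (eq_bigr (fun a => 4 * E a i j ^+ 2)) => [|a _]; first by rewrite -mulr_sumr; lra.
by rewrite hsdotDl !hsdot_delta -{2}[E a]symE mxE; ring.
Qed.

End Bessel.
End HilbertSchmidt.

(** * Commutators with an orthogonal family *)

(** Summing over [a] first turns the family into weights [w i j], whose total is
    [\sum_a hsdot (E a) (E a)]; the two weighted gap bounds then apply. *)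
Lemma sum_commutator_diag_le (R : realType) n (I : finType) (E : I -> 'M[R]_n)
    (d : 'rV[R]_n) :
  (forall a b, a != b -> hsdot (E a) (E b) = 0) ->
  (forall a, hsdot (E a) (E a) <= 1) ->
  (forall a, (E a)^T = E a) -> hsdot (diag_mx d) (diag_mx d) = 1 ->
  let S := \sum_a hsdot (mxcommutator (diag_mx d) (E a))
                        (mxcommutator (diag_mx d) (E a)) in
  S <= 1 + #|I|%:R /\ S <= n%:R.
Proof.
move=> orthE normE symE d1 S; pose w i j := \sum_a E a i j ^+ 2.
have {}d1 : \sum_i d 0 i ^+ 2 = 1.
  rewrite -d1 hsdotE; apply: eq_bigr => i _; rewrite (bigD1 i) //= big1.
    by rewrite addr0 !mxE eqxx.
  by move=> j ji; rewrite !mxE eq_sym (negPf ji) mul0r.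
have -> : S = \sum_i \sum_j w i j * (d 0 i - d 0 j) ^+ 2.
  rewrite /S (eq_bigr _ (fun a _ => mxcommutator_diag d (E a))) exchange_big /=.
  apply: eq_bigr => i _; rewrite exchange_big /=.
  by apply: eq_bigr => j _; rewrite mulr_suml.
have w_le i j : i != j -> w i j <= 2^-1 by apply: sum_entry_sqr_le.
split; last by have := sum_weighted_gaps_le_card d1 w_le; rewrite card_ord.
apply: sum_weighted_gaps_le => // [i j|]; first by apply: sumr_ge0 => a _; apply: sqr_ge0.
have -> : \sum_i \sum_j w i j = \sum_a hsdot (E a) (E a).
  under [RHS]eq_bigr do rewrite hsdotE.
  rewrite [RHS]exchange_big /=; apply: eq_bigr => i _.
  by rewrite [RHS]exchange_big.
by rewrite -sumr_const; apply: ler_sum.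
Qed.

(** Conjugation by an orthogonal matrix preserves inner products, symmetry and commutators, which
    reduces the claim to a diagonal matrix. *)
Lemma sum_commutator_le (R : realType) n (I : finType) (E : I -> 'M[R]_n)
    (A : 'M[R]_n) :
  (forall a b, a != b -> hsdot (E a) (E b) = 0) ->
  (forall a, hsdot (E a) (E a) <= 1) ->
  (forall a, (E a)^T = E a) -> A^T = A -> hsdot A A = 1 ->
  let S := \sum_a hsdot (mxcommutator A (E a)) (mxcommutator A (E a)) in
  S <= 1 + #|I|%:R /\ S <= n%:R.
Proof.
move=> orthE normE symE symA A1.
have [P [d [PP PA]]] := symmetric_diagonalizable symA.
move=> S; pose F a := P *m E a *m P^T.
have -> : S = \sum_a hsdot (mxcommutator (diag_mx d) (F a))
                           (mxcommutator (diag_mx d) (F a)).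
  by apply: eq_bigr => a _; rewrite -PA mxcommutator_conj // hsdot_conj.
apply: sum_commutator_diag_le => [a b ab|a|a|].
- by rewrite hsdot_conj ?orthE.
- by rewrite hsdot_conj.
- by rewrite !trmx_mul trmxK symE mulmxA.
- by rewrite -PA hsdot_conj.
Qed.

(* The family A_2, ..., A_m is the restriction of [B] to the indices
   2 <= a <= m; the values of [B] at other indices are irrelevant. *)
Theorem theorem2p5 (R : realType) (n m : nat) (hm : (2 <= m)%N)
    (A : 'M[R]_n) (B : nat -> 'M[R]_n)
    (symA : A \is symmetricmx)
    (symB : forall a : nat, (2 <= a <= m)%N -> B a \is symmetricmx)
    (normA : hsnorm A = 1) (trA : \tr A = 0)
    (orthB : forall a b : nat, (2 <= a)%N -> (a < b)%N -> (b <= m)%N ->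
       hsdot (B a) (B b) = 0)
    (decrB : forall a : nat, (2 <= a)%N -> (a < m)%N ->
       hsnorm (B a.+1) <= hsnorm (B a)) :
  \sum_(2 <= a < m.+1) hsnorm (mxcommutator A (B a)) ^+ 2 <=
    hsnorm (B 2%N) ^+ 2 + \sum_(2 <= a < (minn m n).+1) hsnorm (B a) ^+ 2.
Proof.
have symM (M : 'M[R]_n) : M \is symmetricmx -> M^T = M.
  by move/is_hermitianmxP => {2}->; rewrite expr0 scale1r map_mx_id.
(* The empty matrix has norm 0, against [normA]. Positivity is what makes [n.-1 + 1] equal to [n]
   below. *)
have n_gt0 : (0 < n)%N.
  case: n A normA {symA symB trA orthB decrB symM B} => // A' /eqP.
  by rewrite /hsnorm flatmx0 hsdotE big_ord0 sqrtr0 eq_sym oner_eq0.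
(* Indices are shifted by 2, so [N] is the number of matrices [B 2], ..., [B m]. *)
pose N := m.-1; pose b i := hsnorm (B i.+2) ^+ 2.
(* E i = 0 when B i.+2 = 0, as 0^-1 = 0. *)
pose E i := (hsnorm (B i.+2))^-1 *: B i.+2.
pose x i := hsdot (mxcommutator A (E i)) (mxcommutator A (E i)).
have BE i : B i.+2 = hsnorm (B i.+2) *: E i.
  have [B0|B_neq0] := eqVneq (hsnorm (B i.+2)) 0.
    by rewrite B0 scale0r; exact: hsnorm_eq0.
  by rewrite scalerA mulfV // scale1r.
have bx i : hsnorm (mxcommutator A (B i.+2)) ^+ 2 = b i * x i.
  have -> : mxcommutator A (B i.+2) = hsnorm (B i.+2) *: mxcommutator A (E i).
    by rewrite /mxcommutator scalerBr scalemxAr scalemxAl -BE.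
  by rewrite hsnorm_sqr hsdotZl hsdotZr mulrA -expr2.
have normE i : hsdot (E i) (E i) <= 1.
  rewrite hsdotZl hsdotZr -hsnorm_sqr mulrA -expr2 -exprMn.
  have [->|B_neq0] := eqVneq (hsnorm (B i.+2)) 0; first by rewrite mulr0 expr0n ler01.
  by rewrite mulVf // expr1n.
have x_le k : (k <= N)%N -> \sum_(i < k) x i <= 1 + k%:R /\ \sum_(i < k) x i <= n%:R.
  move=> kN.
  have idx (i : 'I_k) : (i.+2 <= m)%N.
    by have := ltn_ord i; move: kN hm; rewrite /N; lia.
  have := @sum_commutator_le _ _ _ (fun i : 'I_k => E i) A.
  rewrite card_ord; apply=> // [i j ij|i||].
  - rewrite hsdotZl hsdotZr; case: (ltngtP i j) => [lt_ij|lt_ji|/val_inj eq_ij].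
    + by rewrite orthB ?mulr0.
    + by rewrite hsdotC orthB ?mulr0.
    + by rewrite eq_ij eqxx in ij.
  - by rewrite linearZ /= symM // symB // idx.
  - exact: symM.
  - by rewrite -hsnorm_sqr normA expr1n.
(* The subtracted indicators encode the right-hand side: weighted by [b], the first sums to [b 0]
   and the second to the sum of [b i] over [i < minn N n.-1]. *)
pose y i := x i - (i == 0)%:R - (i < n.-1)%:R.
have by_le0 : \sum_(i < N) b i * y i <= 0.
  apply: sum_decr_mul_le0 => [i _|i iN|k kN]; first exact: sqr_ge0.
    rewrite ler_sqr ?nnegrE ?sqrtr_ge0 // decrB //.
    by move: iN hm; rewrite /N; lia.
  have [x_le1 x_le2] := x_le k kN.
  rewrite !sumrB; have := sum_ord_mul_ltn (fun=> 1 : R) k n.-1.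
  under eq_bigr do rewrite mul1r.
  move=> ->; rewrite sumr_const card_ord.
  case: k kN x_le1 x_le2 => [|k] kN x_le1 x_le2.
    by rewrite !big_ord0 min0n !subr0.
  have -> : \sum_(i < k.+1) (i == 0 :> nat)%:R = 1 :> R.
    by rewrite big_ord_recl big1 ?addr0.
  (* The bound [1 + k.+1] settles the case [k.+1 <= n.-1], and the bound [n] settles the other. *)
  have := leq_total k.+1 n.-1 => /orP [/minn_idPl ->|/minn_idPr ->]; first by lra.
  have : n%:R = 1 + n.-1%:R :> R by rewrite nat1r prednK.
  by lra.
have -> : \sum_(2 <= a < m.+1) hsnorm (mxcommutator A (B a)) ^+ 2 =
    \sum_(i < N) b i * x i.
  rewrite -{1}[2%N]add0n big_addn big_mkord (_ : (m.+1 - 2 = N)%N); last by rewrite /N; lia.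
  by apply: eq_bigr => i _; rewrite addn2 bx.
have -> : \sum_(2 <= a < (minn m n).+1) hsnorm (B a) ^+ 2 =
    \sum_(i < minn N n.-1) b i.
  rewrite -{1}[2%N]add0n big_addn big_mkord.
  rewrite (_ : ((minn m n).+1 - 2 = minn N n.-1)%N); last by rewrite /N; lia.
  by apply: eq_bigr => i _; rewrite addn2.
have {}by_le0 : \sum_(i < N) b i * x i - \sum_(i < N) b i * (i == 0 :> nat)%:R
    - \sum_(i < N) b i * (i < n.-1)%:R <= 0.
  by rewrite -!sumrB; under eq_bigr do rewrite -!mulrBr.
move: by_le0; rewrite sum_ord_mul_ltn.
have -> : \sum_(i < N) b i * (i == 0 :> nat)%:R = b 0.
  have /prednK <- : (0 < N)%N by rewrite /N; lia.
  by rewrite big_ord_recl big1 ?addr0 ?mulr1 // => i _; rewrite mulr0.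
by rewrite /b; lra.
Qed.
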